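(* Let $T>0$ and suppose $L=\{L(s),\,s\ge0\}$ is a Lévy process with Laplace exponent $\psi$ well-defined on $[0,2]$ and $$\gamma(h)=\frac12\,\mathbb{E}Y(0)^2\,e^{-\psi(1)h}\left(1+e^{\psi(2)h}-(1-e^{-h})^{-\psi(2)}\right),\quad h\ge0,$$ is a covariance function of a strictly stationary process $Y=\{Y(t),\,t\in\mathbb{R}\}$ independent of $L$. Then the process $\{X(t),\,t\in(0,T]\}$, $$X(t)=e^{L(-\log(t/T))}\,Y(\log(t/T)),\quad t\in(0,T],$$ is multifractal with $\Lambda=(0,1]$, $\mathcal{S}=(0,T]$ and $$\mathbb{E}X(t)X(s)=\frac12\,T^{\psi(2)}\,\mathbb{E}X(1)^2\left(t^{-\psi(2)}+s^{-\psi(2)}-|t-s|^{-\psi(2)}\right),\quad t,s\in(0,T].$$ In particular, for any $\varepsilon>0$ the sequence $X(t_j+\varepsilon)-X(t_j)$, $j=1,\dots,\lfloor T/\varepsilon\rfloor$, is weakly stationary with $$\mathbb{E}\big(X(t_j+\varepsilon)-X(t_j)\big)\big(X(t_i+\varepsilon)-X(t_i)\big)=\frac12\,\varepsilon^{-\psi(2)}\,\mathbb{E}X(1)^2\left(|j-i+1|^{-\psi(2)}+|j-i-1|^{-\psi(2)}-2|j-i|^{-\psi(2)}\right).$$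
   Context: All processes are real-valued and assumed not identically null; $\{\cdot\}\overset{d}{=}\{\cdot\}$ denotes equality of finite dimensional distributions. A Lévy process is a process starting at zero, with stationary independent increments, and stochastically continuous. The Laplace exponent $\psi$ of $L$ is defined by $\mathbb{E}[e^{qL(s)}]=e^{s\psi(q)}$, $s\ge0$; it is well-defined at $q$ when these expectations are finite. A process $X=\{X(t),\,t\in\mathcal{T}\}$ is multifractal with sets $\Lambda\subset(0,\infty)$ and $\mathcal{S}\subset\mathcal{T}$ if for every $\lambda\in\Lambda$ there exists a family of identically distributed positive random variables $\{M(\lambda,t),\,t\in\mathcal{S}\}$, independent of $\{X(t)\}$, such that $\{X(\lambda t)\}_{t\in\mathcal{S}}\overset{d}{=}\{M(\lambda,t)X(t)\}_{t\in\mathcal{S}}$. That $\gamma$ is the covariance function of $Y$ means $\mathbb{E}[Y(u+h)Y(u)]=\gamma(h)$ (product moments, not centered). The $t_j$ are consecutive time points with spacing $\varepsilon$, that is, $t_{j+1}=t_j+\varepsilon$. Weak stationarity is meant in the sense that the product moments of the sequence depend only on $|j-i|$, as in the displayed formula.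
   Formalization: First display has E X(T)² for E X(1)² (false as printed for T>1: put t=s=1); the second keeps E X(1)² if T≥1 and has T^{ψ(2)}E X(T)² for all T, as X(1) is undefined if T<1. Only increments with t_j, t_j+ε in (0,T] count; M may live on an extended space. *)

(* Defs.v *)
From HB Require Import structures.
From mathcomp Require Import all_boot all_order all_algebra.
From mathcomp Require Import all_classical all_reals all_analysis.

Set Implicit Arguments.
Unset Strict Implicit.
Unset Printing Implicit Defensive.

Import Order.TTheory GRing.Theory Num.Theory.
Import numFieldNormedType.Exports.

Local Open Scope classical_set_scope.
Local Open Scope ring_scope.

(** A process with index set [D] is a total map [X : R -> Omega -> R] of which
    only the values [X t] with [D t] matter; it is never identically null. *)
Definition real_process (R : realType) (d : measure_display)
    (Omega : measurableType d) (P : probability Omega R) (D : set R)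
    (X : R -> Omega -> R) : Prop :=
  (forall t, D t -> measurable_fun setT (X t)) /\
  ~ (forall t, D t -> {ae P, forall w, X t w = 0}).

Definition same_law (R : realType)
    (d : measure_display) (Omega : measurableType d) (P : probability Omega R)
    (d' : measure_display) (Omega' : measurableType d')
    (P' : probability Omega' R) (U : Omega -> R) (V : Omega' -> R) : Prop :=
  forall B : set R, measurable B -> P (U @^-1` B) = P' (V @^-1` B).

Definition sample (R : realType) (Omega : Type) (X : R -> Omega -> R)
    (n : nat) (t : n.-tuple R) (w : Omega) : n.-tuple R :=
  [tuple X (tnth t i) w | i < n].

(** Equality of finite dimensional distributions over the index set [S]. *)
Definition same_fdd (R : realType) (S : set R)
    (d : measure_display) (Omega : measurableType d) (P : probability Omega R)
    (X : R -> Omega -> R)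
    (d' : measure_display) (Omega' : measurableType d')
    (P' : probability Omega' R) (X' : R -> Omega' -> R) : Prop :=
  forall (n : nat) (t : n.-tuple R), (forall i, S (tnth t i)) ->
  forall B : set (n.-tuple R), measurable B ->
    P (sample X t @^-1` B) = P' (sample X' t @^-1` B).

Definition process_sigma (R : realType) (d : measure_display)
    (Omega : measurableType d) (D : set R) (X : R -> Omega -> R) :
    set (set Omega) :=
  <<s [set A | exists t : R, exists B : set R,
                 [/\ D t, measurable B & A = X t @^-1` B]] >>.

Definition independent_processes (R : realType) (d : measure_display)
    (Omega : measurableType d) (P : probability Omega R)
    (D : set R) (X : R -> Omega -> R) (E : set R) (Y : R -> Omega -> R) : Prop :=
  forall A B : set Omega, process_sigma D X A -> process_sigma E Y B ->
    P (A `&` B) = (P A * P B)%E.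

Definition increment (R : realType) (Omega : Type) (X : R -> Omega -> R)
    (s t : R) (w : Omega) : R := X t w - X s w.

Definition independent_increments (R : realType) (d : measure_display)
    (Omega : measurableType d) (P : probability Omega R)
    (L : R -> Omega -> R) : Prop :=
  forall (n : nat) (t : nat -> R), 0 <= t 0%N -> (forall i, t i <= t i.+1) ->
  forall B : nat -> set R, (forall i, measurable (B i)) ->
    P (\bigcap_(i in [set i | (i < n)%N])
         (increment L (t i) (t i.+1) @^-1` B i)) =
    (\prod_(0 <= i < n) P (increment L (t i) (t i.+1) @^-1` B i))%E.

Definition stationary_increments (R : realType) (d : measure_display)
    (Omega : measurableType d) (P : probability Omega R)
    (L : R -> Omega -> R) : Prop :=
  forall s h : R, 0 <= s -> 0 <= h ->
    same_law P P (increment L s (s + h)) (increment L 0 h).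

Definition stochastically_continuous (R : realType) (d : measure_display)
    (Omega : measurableType d) (P : probability Omega R)
    (L : R -> Omega -> R) : Prop :=
  forall t e : R, 0 <= t -> 0 < e ->
    (fun s => P [set w | e < `|L s w - L t w|])
      @ within `[0, +oo[ (nbhs t) --> 0%E.

Definition levy_process (R : realType) (d : measure_display)
    (Omega : measurableType d) (P : probability Omega R)
    (L : R -> Omega -> R) : Prop :=
  [/\ real_process P `[0, +oo[ L,
      {ae P, forall w, L 0 w = 0},
      independent_increments P L,
      stationary_increments P L
    & stochastically_continuous P L].

(** [psi] is the Laplace exponent of [L] on [Q], and is well-defined there:
    the right-hand side is finite, hence so are the moments. *)
Definition laplace_exponent_on (R : realType) (d : measure_display)
    (Omega : measurableType d) (P : probability Omega R)
    (L : R -> Omega -> R) (Q : set R) (psi : R -> R) : Prop :=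
  forall q s : R, Q q -> 0 <= s -> 'M_P (L s) q = (expR (s * psi q))%:E.

Definition strictly_stationary (R : realType) (d : measure_display)
    (Omega : measurableType d) (P : probability Omega R)
    (Y : R -> Omega -> R) : Prop :=
  forall h : R, same_fdd setT P (fun t => Y (t + h)) P Y.

Definition product_moment (R : realType) (d : measure_display)
    (Omega : measurableType d) (P : probability Omega R)
    (U V : Omega -> R) : \bar R := ('E_P[fun w => (U w * V w)%R])%E.

(** Product moments, not centered. *)
Definition covariance_function (R : realType) (d : measure_display)
    (Omega : measurableType d) (P : probability Omega R)
    (Y : R -> Omega -> R) (g : R -> R) : Prop :=
  (forall u : R, (product_moment P (Y u) (Y u) < +oo)%E) /\
  (forall u h : R, 0 <= h -> product_moment P (Y (u + h)) (Y u) = (g h)%:E).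

(** The multiplier [M] need not exist on the space carrying [X]: as usual in an
    identity in law, it may live on an extension [pi : Omega' -> Omega] of it,
    on which [X] is read as [X \o pi]. *)
Definition multifractal (R : realType) (d : measure_display)
    (Omega : measurableType d) (P : probability Omega R)
    (D : set R) (X : R -> Omega -> R) (Lambda S : set R) : Prop :=
  [/\ real_process P D X,
      Lambda `<=` [set l | 0 < l],
      S `<=` D,
      (forall l t, Lambda l -> S t -> D (l * t))
    & forall l, Lambda l ->
      exists (d' : measure_display) (Omega' : measurableType d')
             (P' : probability Omega' R) (pi : Omega' -> Omega)
             (M : R -> Omega' -> R),
        [/\ measurable_fun setT pi /\
              (forall A, measurable A -> P' (pi @^-1` A) = P A),
            (forall t, S t ->
               measurable_fun setT (M t) /\ forall w, 0 < M t w),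
            (forall t s, S t -> S s -> same_law P' P' (M t) (M s)),
            independent_processes P' S M D (fun t => X t \o pi)
          & same_fdd S P (fun t => X (l * t))
                       P' (fun t => M t \* (X t \o pi))] ].

Definition weakly_stationary (R : realType) (d : measure_display)
    (Omega : measurableType d) (P : probability Omega R)
    (J : set nat) (Z : nat -> Omega -> R) : Prop :=
  exists g : nat -> R, forall i j, J i -> J j ->
    product_moment P (Z j) (Z i) = (g `|j%:Z - i%:Z|%N)%:E.

(** At [h = 0] the last summand is [0 `^ (- psi 2)], which is [0] for
    [psi 2 < 0]; the requirement that [gamma] be a covariance function rules
    out [0 <= psi 2]. *)
Definition gamma (R : realType) (d : measure_display)
    (Omega : measurableType d) (P : probability Omega R)
    (Y : R -> Omega -> R) (psi : R -> R) (h : R) : R :=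
  2^-1 * fine (product_moment P (Y 0) (Y 0)) * expR (- psi 1 * h) *
  (1 + expR (psi 2 * h) - (1 - expR (- h)) `^ (- psi 2)).

Definition levy_stationary_product (R : realType) (Omega : Type) (T : R)
    (L Y : R -> Omega -> R) (t : R) (w : Omega) : R :=
  expR (L (- ln (t / T)) w) * Y (ln (t / T)) w.

(** The indices [1 <= j <= floor (T / eps)] whose increment over
    [tau j, tau j + eps] lies in the index set [(0, T]]. *)
Definition increment_indices (R : realType) (T eps : R) (tau : nat -> R) :
    set nat :=
  [set j | [/\ (1 <= j)%N, j%:Z <= Num.floor (T / eps),
              0 < tau j & tau j + eps <= T]].

(* Main.v *)
Require Import Defs.
From HB Require Import structures.
From mathcomp Require Import all_boot all_order all_algebra.
From mathcomp Require Import all_classical all_reals all_analysis.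
From mathcomp Require Import measurable_realfun.
From mathcomp Require Import ring lra.

Import Order.TTheory GRing.Theory Num.Theory.
Import numFieldNormedType.Exports.

Local Open Scope classical_set_scope.
Local Open Scope ring_scope.

(** Fix [0 < l <= 1] and put [a = - ln l].  Reading [X] on the time scale
    [s = - ln (t / T)], so that [X t = exp (L s) * Y (- s)], a dilation of [t]
    by [l] is a shift of [s] by [a]:
      [X (l * t) = exp (L a - L 0) * (exp (L 0 + (L (a + s) - L a)) * Y (- s - a))].
    The increments of [L] after [a] are independent of [L a - L 0] and
    distributed as those of [L] after [0], while [Y] is stationary and
    independent of [L].  So, jointly in [t], the right-hand side has the law of
    [M * X t] where [M] is an independent copy of [exp (L a - L 0)]; such a copy
    is found on the second factor of [Omega * Omega].  The joint law of finitely
    many increments of [L] and finitely many values of [Y] is computed on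
    rectangles ([levy_rectangle]), which determine it ([eqlaw_tuple_pair]); this
    gives the identity for increments ([levy_restart_law]), and summing the
    increments over an ordered grid of times gives it for the processes
    ([exp_levy_stationary_restart]).

    For the moments let [t <= s] and let [b <= a] be the images
    [- ln (s / T)], [- ln (t / T)] on the additive scale.  By independence of
    [L] and [Y], and of the increments of [L] over [[0, b]] and [[b, a]],
      [E (X t * X s) = E (exp (2 L b)) * E (exp (L (a - b))) * gamma (a - b)]
    ([product_moment_exp_scale]), which is
    [exp (b * psi 2 + (a - b) * psi 1) * gamma (a - b)].  The factor
    [exp (- psi 1 * h)] of [gamma] cancels the [psi 1] term, and
    [exp (b - a) = t / s] turns [1 - exp (b - a)] into [(s - t) / s], leaving a
    combination of powers of [t], [s] and [s - t] ([gamma_scale]).  This is the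
    covariance of a process whose increments have stationary covariances: in
    the second difference over two intervals of length [eps] the terms in [t]
    alone and in [s] alone cancel. *)

(** * Laws and independence of random elements *)

(** [same_law] for elements of an arbitrary measurable space, as needed for the
    joint law of a tuple of increments of [L] and a tuple of values of [Y]. *)
Definition eqlaw {R : realType} {d d1 d' : measure_display}
    {T : measurableType d} {T1 : measurableType d1} {E : measurableType d'}
    (P : probability T R) (U : T -> E) (Q : probability T1 R) (V : T1 -> E) :=
  forall B, measurable B -> P (U @^-1` B) = Q (V @^-1` B).

Definition indep {R : realType} {d d1 d2 : measure_display}
    {T : measurableType d} {E1 : measurableType d1} {E2 : measurableType d2}
    (P : probability T R) (U : T -> E1) (V : T -> E2) :=
  forall A B, measurable A -> measurable B ->
    P (U @^-1` A `&` V @^-1` B) = (P (U @^-1` A) * P (V @^-1` B))%E.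

Lemma measurable_preimage {d d'} {T : measurableType d} {T' : measurableType d'}
    (f : T -> T') (B : set T') :
  measurable_fun setT f -> measurable B -> measurable (f @^-1` B).
Proof. by move=> mf mB; rewrite -[X in measurable X]setTI; exact: mf. Qed.

(** Rectangles are stable under intersection and generate the product
    sigma-algebra of tuples, so they separate finite measures. *)
Lemma tuple_measure_unique {R : realType} {d} {T : measurableType d} {n : nat}
    (m1 m2 : {measure set (n.-tuple T) -> \bar R}) :
  (m1 setT < +oo)%E ->
  (forall B : 'I_n -> set T, (forall i, measurable (B i)) ->
    m1 [set x | forall i, B i (tnth x i)] =
    m2 [set x | forall i, B i (tnth x i)]) ->
  forall A, measurable A -> m1 A = m2 A.
Proof.
move=> m1oo m12 A mA.
pose G : set (set (n.-tuple T)) := [set A | exists2 B : 'I_n -> set T,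
  forall i, measurable (B i) & A = [set x | forall i, B i (tnth x i)]].
have GT : G setT by exists (fun=> setT) => //; apply/seteqP; split.
apply: (@measure_unique _ _ _ G (fun=> setT)) => //.
- apply/seteqP; split.
  (* a cylinder is a rectangle whose other sides are the whole space *)
  + apply: smallest_sub; first exact: smallest_sigma_algebra.
    rewrite -bigcup_seq => X [i /= _ [B mB <-]].
    apply: sub_sigma_algebra.
    exists (fun j => if j == i then B else setT).
      by move=> j; case: ifP.
    rewrite setTI; apply/seteqP; split => x /=.
      by move=> Bx j; case: eqP => [->|].
    by move=> /(_ i); rewrite eqxx.
  + apply: smallest_sub; first exact: sigma_algebra_measurable.
    move=> _ [B mB ->].
    rewrite [X in measurable X](_ : _ =
        \bigcap_(i in [set: 'I_n]) ((@tnth n T ^~ i) @^-1` B i)); last first.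
      by apply/seteqP; split => x /= h i; [move=> _|]; exact: h.
    apply: fin_bigcap_measurable => // i _.
    by apply: measurable_preimage => //; exact: measurable_tnth.
- move=> _ _ [B mB ->] [C mC ->]; exists (fun i => B i `&` C i).
    by move=> i; exact: measurableI.
  apply/seteqP; split => x /=; first by move=> [Bx Cx] i; split.
  by move=> h; split => i; case: (h i).
- by rewrite bigcup_const//; exists 0%N.
- by move=> _ [B mB ->]; exact: m12.
Qed.

(** The same argument as for tuples, with two heterogeneous components. *)
Lemma eqlaw_pair {R : realType} {d d1 e1 e2 : measure_display}
    {T : measurableType d} {T1 : measurableType d1}
    {E1 : measurableType e1} {E2 : measurableType e2}
    (P : probability T R) (Q : probability T1 R)
    (U : T -> E1) (V : T -> E2) (U1 : T1 -> E1) (V1 : T1 -> E2) :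
  measurable_fun setT U -> measurable_fun setT V ->
  measurable_fun setT U1 -> measurable_fun setT V1 ->
  (forall A B, measurable A -> measurable B ->
     P (U @^-1` A `&` V @^-1` B) = Q (U1 @^-1` A `&` V1 @^-1` B)) ->
  eqlaw P (fun w => (U w, V w)) Q (fun w => (U1 w, V1 w)).
Proof.
move=> mU mV mU1 mV1 h.
pose p := (fun w => (U w, V w)); pose q := (fun w => (U1 w, V1 w)).
have mp : measurable_fun setT p by exact: measurable_fun_pair.
have mq : measurable_fun setT q by exact: measurable_fun_pair.
pose p' : {mfun T >-> (E1 * E2)%type} := HB.pack p (isMeasurableFun.Build _ _ _ _ _ mp).
pose q' : {mfun T1 >-> (E1 * E2)%type} := HB.pack q (isMeasurableFun.Build _ _ _ _ _ mq).
move=> B mB; change (distribution P p' B = distribution Q q' B).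
apply: (@measure_unique _ _ _ [set A `*` B | A in measurable & B in measurable]
   (fun=> setT)) => //.
- by rewrite measurable_prod_measurableType.
- move=> _ _ [A1 mA1 [A2 mA2 <-]] [B1 mB1 [B2 mB2 <-]].
  exists (A1 `&` B1); first exact: measurableI.
  by exists (A2 `&` B2); [exact: measurableI|rewrite setXI].
- by move=> _; exists setT => //; exists setT => //; rewrite setXTT.
- by rewrite bigcup_const//; exists 0%N.
- by move=> _ [A1 mA1 [A2 mA2 <-]]; exact: h.
- by move=> _; apply: le_lt_trans (ltry 1); exact: probability_le1.
Qed.

Lemma eqlaw_ae {R : realType} {d e : measure_display}
    {T : measurableType d} {E : measurableType e}
    (P : probability T R) (U V : T -> E) :
  measurable_fun setT U -> measurable_fun setT V ->
  {ae P, forall w, U w = V w} -> eqlaw P U P V.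
Proof.
move=> mU mV [N [mN PN UV]] B mB.
have mUB := measurable_preimage _ _ mU mB.
have mVB := measurable_preimage _ _ mV mB.
have null X : measurable X -> P (X `&` N) = 0%E.
  by move=> mX; apply: (subset_measure0 _ mN) => //; exact: measurableI.
have split_N X : measurable X -> P X = P (X `\` N).
  move=> mX.
  have -> : P X = (P (X `\` N) + P (X `&` N))%E by exact: measureDI.
  by rewrite null// adde0.
rewrite split_N// [RHS]split_N//; congr (P _).
have NUV w : ~ N w -> U w = V w by apply: contra_notP => h; exact: UV.
by apply/seteqP; split => w [/= Bw /[dup] Nw /NUV UVw]; split => //=;
  rewrite ?UVw// -UVw.
Qed.

Lemma ge0_eqlaw_expectation {R : realType} {d d1 e : measure_display}
    {T : measurableType d} {T1 : measurableType d1} {E : measurableType e}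
    (P : probability T R) (Q : probability T1 R) (U : T -> E) (V : T1 -> E)
    (f : E -> R) :
  measurable_fun setT U -> measurable_fun setT V -> measurable_fun setT f ->
  (forall x, 0 <= f x) -> eqlaw P U Q V ->
  ('E_P[f \o U] = 'E_Q[f \o V])%E.
Proof.
move=> mU mV mf f0 UV.
have mF : measurable_fun setT (fun x => (f x)%:E) by exact/measurable_EFinP.
pose U' : {mfun T >-> E} := HB.pack U (isMeasurableFun.Build _ _ _ _ _ mU).
pose V' : {mfun T1 >-> E} := HB.pack V (isMeasurableFun.Build _ _ _ _ _ mV).
rewrite unlock -(ge0_integral_distribution U' mF)//.
rewrite -(ge0_integral_distribution V' mF)//.
by apply: eq_measure_integral => B mB _; exact: UV.
Qed.

(** Independence says that the joint law is the product of the marginal laws, so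
    this is the theorem of Tonelli (for integrability) and that of Fubini (for
    the value) applied to [(x, y) |-> x * y] under that product. *)
Lemma integrable_expectation_mul_indep {R : realType} {d : measure_display}
    {T : measurableType d} (P : probability T R) (U V : T -> R) :
  indep P U V ->
  P.-integrable setT (EFin \o U) -> P.-integrable setT (EFin \o V) ->
  P.-integrable setT (EFin \o (U \* V)) /\
  ('E_P[fun w => (U w * V w)%R] = 'E_P[U] * 'E_P[V])%E.
Proof.
move=> UV iU iV.
have mU : measurable_fun setT U by apply/measurable_EFinP; exact: measurable_int iU.
have mV : measurable_fun setT V by apply/measurable_EFinP; exact: measurable_int iV.
pose p := (fun w => (U w, V w)).
have mp : measurable_fun setT p by exact: measurable_fun_pair.
pose U' : {mfun T >-> R} := HB.pack U (isMeasurableFun.Build _ _ _ _ _ mU).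
pose V' : {mfun T >-> R} := HB.pack V (isMeasurableFun.Build _ _ _ _ _ mV).
pose p' : {mfun T >-> (R * R)%type} := HB.pack p (isMeasurableFun.Build _ _ _ _ _ mp).
pose dU := distribution P U'; pose dV := distribution P V'.
have dUV B : measurable B -> distribution P p' B = (dU \x dV)%E B.
  by move=> mB; apply/esym/product_measure_unique => // X Y mX mY; exact: UV.
pose f (z : R * R) := (z.1 * z.2)%:E.
have mf : measurable_fun setT f by apply/measurable_EFinP; exact: measurable_funM.
have iid W (W' : {mfun T >-> R}) : W' = W :> (T -> R) ->
    P.-integrable setT (EFin \o W) ->
    (distribution P W').-integrable setT EFin.
  by move=> <- iW; apply: (integrable_pushforward (measurable_funP W')).
have iU' := iid U U' erefl iU; have iV' := iid V V' erefl iV.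
have iE W (W' : {mfun T >-> R}) : W' = W :> (T -> R) ->
    P.-integrable setT (EFin \o W) ->
    (\int[distribution P W']_x x%:E = 'E_P[W])%E.
  by move=> <- iW; rewrite unlock (@integral_distribution _ _ _ _ _ P W' EFin).
have ifd : (dU \x dV)%E.-integrable setT f.
  apply/integrable12ltyP => //.
  rewrite (eq_integral (fun x : R => `|x%:E| * \int[dV]_y `|y%:E|)%E); last first.
    move=> x _; rewrite -ge0_integralZl//; last exact: measurableT_comp.
    by apply: eq_integral => y _; rewrite /f EFinM abseM.
  rewrite ge0_integralZr//; last 2 first.
  - exact: measurableT_comp.
  - by apply: integral_ge0.
  move/integrableP : iU' => [_ iU']; move/integrableP : iV' => [_ iV'].
  by apply: lte_mul_pinfty => //; [apply: integral_ge0|rewrite ge0_fin_numE// integral_ge0].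
have ifp : P.-integrable setT (f \o p).
  apply/integrableP; split; first exact: measurableT_comp.
  move/integrableP : ifd => [_].
  rewrite (eq_measure_integral (distribution P p')); last first.
    by move=> B mB _; exact/esym/dUV.
  by rewrite ge0_integral_distribution//; exact: measurableT_comp.
split; first exact: ifp.
rewrite {1}unlock; transitivity (\int[distribution P p']_z f z)%E.
  by rewrite integral_distribution.
rewrite (eq_measure_integral (dU \x dV)%E); last by move=> B mB _; exact: dUV.
rewrite -integral12_prod_meas1// /fubini_F.
rewrite (eq_integral (fun x : R => x%:E * 'E_P[V])%E); last first.
  move=> x _; rewrite -(iE V V')// -integralZl//.
rewrite -(fineK (expectation_fin_num _)); last exact/Lfun1_integrable.
by rewrite integralZr// (iE U U')// fineK// expectation_fin_num.
Qed.

Lemma measurable_fun_mktuple {d d'} {T : measurableType d}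
    {E : measurableType d'} (n : nat) (U : nat -> T -> E) :
  (forall i, (i < n)%N -> measurable_fun setT (U i)) ->
  measurable_fun setT (fun w => [tuple U i w | i < n]).
Proof.
move=> mU; apply/measurable_fun_tnthP => i.
rewrite (_ : _ \o _ = U i); first exact: mU.
by apply/funext => w /=; rewrite tnth_mktuple.
Qed.

(** For a fixed event [V @^-1` C] the two sides are finite measures on tuples, to
    which uniqueness on rectangles applies; this lets only the tuple components
    be tested on rectangles while [C] stays arbitrary. *)
Lemma eqlaw_tuple_pair {R : realType} {d d1 e e' : measure_display}
    {T : measurableType d} {T1 : measurableType d1}
    {E : measurableType e} {E' : measurableType e'}
    (P : probability T R) (Q : probability T1 R) (n : nat)
    (U : nat -> T -> E) (V : T -> E') (U1 : nat -> T1 -> E) (V1 : T1 -> E') :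
  (forall i, (i < n)%N -> measurable_fun setT (U i)) ->
  measurable_fun setT V ->
  (forall i, (i < n)%N -> measurable_fun setT (U1 i)) ->
  measurable_fun setT V1 ->
  (forall (B : nat -> set E) C, (forall i, measurable (B i)) -> measurable C ->
     P ((\bigcap_(i in [set i | (i < n)%N]) (U i @^-1` B i)) `&` V @^-1` C) =
     Q ((\bigcap_(i in [set i | (i < n)%N]) (U1 i @^-1` B i)) `&` V1 @^-1` C)) ->
  eqlaw P (fun w => ([tuple U i w | i < n], V w))
        Q (fun w => ([tuple U1 i w | i < n], V1 w)).
Proof.
move=> mU mV mU1 mV1 h.
have mX := measurable_fun_mktuple _ _ mU; have mX1 := measurable_fun_mktuple _ _ mU1.
apply: eqlaw_pair => // A C mA mC.
have mVC := measurable_preimage _ _ mV mC.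
have mVC1 := measurable_preimage _ _ mV1 mC.
pose X' : {mfun T >-> (n.-tuple E)%type} :=
  HB.pack (fun w => [tuple U i w | i < n]) (isMeasurableFun.Build _ _ _ _ _ mX).
pose X1' : {mfun T1 >-> (n.-tuple E)%type} :=
  HB.pack (fun w => [tuple U1 i w | i < n]) (isMeasurableFun.Build _ _ _ _ _ mX1).
apply: (@tuple_measure_unique _ _ _ _ (pushforward (mrestr P mVC) X')
  (pushforward (mrestr Q mVC1) X1')) => //.
  apply: le_lt_trans (ltry 1); apply: probability_le1.
  by rewrite preimage_setT setTI.
move=> B mB; rewrite /pushforward /mrestr.
(* the sides of a rectangle, extended from ordinals to all of [nat] *)
pose B' k := if insub k is Some i then B i else setT.
have mB' k : measurable (B' k) by rewrite /B'; case: insub.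
have rectE S (W : nat -> S -> E) :
    (fun w => [tuple W i w | i < n]) @^-1` [set x | forall i, B i (tnth x i)] =
    \bigcap_(i in [set i | (i < n)%N]) (W i @^-1` B' i).
  apply/seteqP; split => w /=.
    move=> Bw k /= kn; rewrite /B' insubT/=.
    by have := Bw (Ordinal kn); rewrite tnth_mktuple.
  move=> Bw i; rewrite tnth_mktuple; have := Bw i (ltn_ord i).
  by rewrite /B' /= valK.
by have := h B' C mB' mC; rewrite -!rectE.
Qed.

(** * Events and functionals of a process *)

(** The generators of [process_sigma D X], named so that [process_sigma D X] is
    the family of measurable sets of [g_sigma_algebraType (process_events D X)]. *)
Definition process_events {R : realType} {Omega : Type} (D : set R)
    (X : R -> Omega -> R) : set (set Omega) :=
  [set A | exists t : R, exists B : set R,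
     [/\ D t, measurable B & A = X t @^-1` B]].

(** Measurability with respect to the sigma-algebra of the process [X]: through
    this encoding the closure lemmas on measurable functions transfer events of
    a process to functionals of it. *)
Definition observable {R : realType} {d d'} {Omega : measurableType d}
    {E : measurableType d'} (D : set R) (X : R -> Omega -> R) (U : Omega -> E) :=
  measurable_fun setT (U : g_sigma_algebraType (process_events D X) -> E).

Lemma observable_coord {R : realType} {d} {Omega : measurableType d}
    (D : set R) (X : R -> Omega -> R) t : D t -> observable D X (X t).
Proof.
move=> Dt _ B mB; rewrite setTI; apply: sub_sigma_algebra.
by exists t, B.
Qed.

Lemma process_sigma_sub {R : realType} {d} {Omega : measurableType d}
    (D : set R) (X : R -> Omega -> R) :
  (forall t, D t -> measurable_fun setT (X t)) ->
  process_sigma D X `<=` measurable.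
Proof.
move=> mX; apply: smallest_sub; first exact: sigma_algebra_measurable.
by move=> _ [t [B [Dt mB ->]]]; exact: measurable_preimage (mX t Dt) mB.
Qed.

Lemma observable_event {R : realType} {d d'} {Omega : measurableType d}
    {E : measurableType d'} (D : set R) (X : R -> Omega -> R) (U : Omega -> E) B :
  observable D X U -> measurable B -> process_sigma D X (U @^-1` B).
Proof. by move=> mU mB; rewrite -[_ @^-1` _]setTI; exact: mU. Qed.

Lemma observable_measurable {R : realType} {d d'} {Omega : measurableType d}
    {E : measurableType d'} (D : set R) (X : R -> Omega -> R) (U : Omega -> E) :
  (forall t, D t -> measurable_fun setT (X t)) ->
  observable D X U -> measurable_fun setT U.
Proof.
move=> mX oU _ B mB; rewrite setTI.
by apply: (process_sigma_sub D X mX); exact: observable_event oU mB.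
Qed.

Lemma independent_processes_indep {R : realType} {d d1 d2}
    {Omega : measurableType d} {E1 : measurableType d1} {E2 : measurableType d2}
    (P : probability Omega R) (D1 : set R) (X : R -> Omega -> R)
    (D2 : set R) (Y : R -> Omega -> R) (U : Omega -> E1) (V : Omega -> E2) :
  independent_processes P D1 X D2 Y ->
  observable D1 X U -> observable D2 Y V -> indep P U V.
Proof. by move=> XY oU oV A B mA mB; apply: XY; exact: observable_event. Qed.

(** * Regeneration of the increments of a Levy process *)

Lemma observable_increment {R : realType} {d} {Omega : measurableType d}
    (D : set R) (X : R -> Omega -> R) s t :
  D s -> D t -> observable D X (increment X s t).
Proof. by move=> Ds Dt; apply: measurable_funB; exact: observable_coord. Qed.

(** Both kinds of independence at once: the increments are independent of each
    other, and as functionals of [L] they are independent of a functional [V]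
    of [Y]. *)
Lemma levy_rectangle {R : realType} {d d'} {Omega : measurableType d}
    {E : measurableType d'} (P : probability Omega R) (L Y : R -> Omega -> R)
    (V : Omega -> E) (n : nat) (t : nat -> R) (B : nat -> set R) (C : set E) :
  independent_increments P L ->
  independent_processes P `[0, +oo[ L setT Y -> observable setT Y V ->
  0 <= t 0%N -> (forall i, t i <= t i.+1) ->
  (forall i, measurable (B i)) -> measurable C ->
  (P ((\bigcap_(i in [set i | (i < n)%N])
        (increment L (t i) (t i.+1) @^-1` B i)) `&` V @^-1` C) =
   (\prod_(0 <= i < n) P (increment L (t i) (t i.+1) @^-1` B i)) *
   P (V @^-1` C))%E.
Proof.
move=> incL LY oV t0 tS mB mC.
have t_ge0 i : 0 <= t i by elim: i => // i /le_trans; apply.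
rewrite LY ?incL//; last exact: observable_event.
apply: (@fin_bigcap_measurable _
  (g_sigma_algebraType (process_events `[0, +oo[ L))).
  by apply: sub_finite_set (finite_II n) => i.
by move=> i _; apply: observable_event => //;
  apply: observable_increment; rewrite /= in_itv/= andbT.
Qed.

(** The regeneration of [L] at time [a]: the increment over [[0, a]] may be taken
    from an independent copy [w.2] and the later increments be moved back by
    [a].  On rectangles both sides are products of one-dimensional
    probabilities that agree by stationarity of the increments. *)
Lemma levy_restart_law {R : realType} {d d'} {Omega : measurableType d}
    {E : measurableType d'} (P : probability Omega R) (L Y : R -> Omega -> R)
    (V W : Omega -> E) (n : nat) (a : R) (u : nat -> R) :
  levy_process P L -> (forall t, measurable_fun setT (Y t)) ->
  independent_processes P `[0, +oo[ L setT Y ->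
  observable setT Y V -> observable setT Y W -> eqlaw P V P W ->
  0 <= a -> u 0%N = 0 -> (forall i, u i <= u i.+1) ->
  eqlaw
    P (fun w => ([tuple (if i : nat is j.+1
                         then increment L (a + u j) (a + u j.+1)
                         else increment L 0 a) w | i < n.+1], V w))
    (P \x P)%E
      (fun w => ([tuple if i : nat is j.+1
                        then increment L (u j) (u j.+1) w.1
                        else increment L 0 a w.2 | i < n.+1], W w.1)).
Proof.
move=> [[mL _] L0 incL statL _] mY LY oV oW VW a0 u0 uS.
have u_ge0 i : 0 <= u i by elim: i => [|i /le_trans]; [rewrite u0|apply].
have nn s : 0 <= s -> `[0, +oo[%classic s by move=> s0; rewrite /= in_itv/= s0.
have mI s t : 0 <= s -> 0 <= t -> measurable_fun setT (increment L s t).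
  by move=> s0 t0; apply: measurable_funB; apply: mL; exact: nn.
have mV : measurable_fun setT V by apply: observable_measurable oV => t _; exact: mY.
have mW : measurable_fun setT W by apply: observable_measurable oW => t _; exact: mY.
(* the times of the increments on the left: [0, a + u 0 = a, a + u 1], and so on *)
pose t k := if k is j.+1 then a + u j else 0.
have tE k : increment L (t k) (t k.+1) =
    (if k is j.+1 then increment L (a + u j) (a + u j.+1) else increment L 0 a).
  by case: k => [|k]; rewrite /t//= u0 addr0.
apply: (@eqlaw_tuple_pair _ _ _ _ _ _ _ _ _ P (P \x P)%E n.+1
  (fun i => if i is j.+1 then increment L (a + u j) (a + u j.+1)
            else increment L 0 a) V
  (fun i w => if i is j.+1 then increment L (u j) (u j.+1) w.1
              else increment L 0 a w.2) (W \o fst)).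
- by case=> [|i] _; apply: mI => //; exact: addr_ge0.
- by [].
- by case=> [|i] _ /=; apply: measurableT_comp => //; exact: mI.
- exact: measurableT_comp.
move=> B C mB mC.
under eq_bigcapr do rewrite -tE.
rewrite (levy_rectangle _ _ _ _ _ t _ _ incL LY oV)//; last first.
  by case=> [|i]; rewrite /t ?u0 ?addr0// lerD2l.
(* on the product space only the first increment depends on [w.2] *)
rewrite (_ : _ `&` _ =
    ((\bigcap_(i in [set i | (i < n)%N])
        (increment L (u i) (u i.+1) @^-1` B i.+1)) `&` W @^-1` C) `*`
    (increment L 0 a @^-1` B 0%N)); last first.
  apply/seteqP; split => -[w w'] /=.
    move=> [Bw Cw]; split; last exact: (Bw 0%N).
    by split => // i /= iN; exact: (Bw i.+1).
  by move=> [[Bw Cw] B0]; split => // -[|i]//= iN; exact: Bw.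
have mBu : measurable ((\bigcap_(i in [set i | (i < n)%N])
    (increment L (u i) (u i.+1) @^-1` B i.+1)) `&` W @^-1` C).
  apply: measurableI; last exact: measurable_preimage.
  apply: bigcap_measurableType => i _; apply: measurable_preimage => //.
  exact: mI.
have mB0 : measurable (increment L 0 a @^-1` B 0%N).
  by apply: measurable_preimage => //; exact: mI.
transitivity ((\prod_(0 <= i < n) P (increment L (u i) (u i.+1) @^-1` B i.+1)) *
    P (W @^-1` C) * P (increment L 0 a @^-1` B 0%N))%E; last first.
  apply/esym; rewrite [LHS]product_measure1E//; congr (_ * _)%E.
  exact: (levy_rectangle _ _ _ _ _ u _ _ incL LY oW).
rewrite big_nat_recl// (VW _ mC) [RHS]muleC muleA tE.
congr (_ * _ * _)%E; apply: eq_bigr => i _; rewrite tE.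
have stat s s' X : 0 <= s -> s <= s' -> measurable X ->
    P (increment L s s' @^-1` X) = P (increment L 0 (s' - s) @^-1` X).
  move=> s0 ss' mX; have h0 : 0 <= s' - s by rewrite subr_ge0.
  by rewrite -(statL s _ s0 h0 X mX) addrC subrK.
rewrite stat ?addr_ge0 ?lerD2l// [RHS]stat//.
by rewrite (_ : a + u i.+1 - (a + u i) = u i.+1 - u i)//; ring.
Qed.

(** * Regeneration of the exponential of a Levy process *)

(** Increments are taken along ordered times, whereas finite dimensional laws
    are tested at times in any order and with repetitions: every finite family
    of times lies on a monotone grid started at [0]. *)
Lemma nondecreasing_grid {R : realType} (s : seq R) :
  (forall x, x \in s -> 0 <= x) ->
  exists u : nat -> R, [/\ u 0%N = 0, forall i, u i <= u i.+1
    & forall x, x \in s -> exists2 k, (k <= size s)%N & u k = x].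
Proof.
move=> s_ge0; pose v := sort <=%O s.
have v_ge0 x : x \in v -> 0 <= x by rewrite mem_sort; exact: s_ge0.
have v_sorted : sorted <=%O (0 :: v).
  rewrite /= path_min_sorted; first exact: sort_le_sorted.
  exact/allP.
(* the default value keeps the grid constant beyond the largest time *)
exists (nth (last 0 v) (0 :: v)); split => // [i|x].
  have [iv|vi] := ltnP i.+1 (size (0 :: v)).
    by move/sortedP : v_sorted; apply.
  rewrite [leRHS]nth_default//.
  move: vi; rewrite /= ltnS leq_eqVlt => /orP[/eqP <-|vi].
    by rewrite -[size v]/((size (0 :: v)).-1) nth_last.
  by rewrite nth_default.
rewrite -(mem_sort <=%O) -/v => xv; exists (index x v).+1.
  by rewrite -(size_sort <=%O s) index_mem.
by rewrite /= nth_index.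
Qed.

Lemma telescope_increment {R : realType} {Omega : Type} (L : R -> Omega -> R)
    (u : nat -> R) k w :
  L (u k) w = L (u 0%N) w + \sum_(0 <= j < k) increment L (u j) (u j.+1) w.
Proof. by rewrite telescope_sumr// addrC subrK. Qed.

(** Rebuilds values [exp (L r_i) * Y_i] from the increments [z.1] of [L] and the
    values [z.2] of [Y]: [L r_i] is the sum of the increment over [[0, a]] and of
    the next [k i] ones.  Used with [k i <= n], where [inord j] is [j]. *)
Definition exp_sum_prod {R : realType} {n m : nat} (k : 'I_m -> nat)
    (z : n.+1.-tuple R * m.-tuple R) : m.-tuple R :=
  [tuple expR (\sum_(0 <= j < (k i).+1) tnth z.1 (inord j)) * tnth z.2 i | i < m].

Lemma measurable_exp_sum_prod {R : realType} {n m : nat} (k : 'I_m -> nat) :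
  measurable_fun setT (@exp_sum_prod R n m k).
Proof.
apply/measurable_fun_tnthP => i.
rewrite (_ : _ \o _ = fun z : n.+1.-tuple R * m.-tuple R =>
    expR (\sum_(0 <= j < (k i).+1) tnth z.1 (inord j)) * tnth z.2 i); last first.
  by apply/funext => z /=; rewrite tnth_mktuple.
apply: measurable_funM.
  apply: measurableT_comp => //; apply: measurable_sum => j.
  by apply: (measurableT_comp (measurable_tnth _)).
by apply: (measurableT_comp (measurable_tnth _)).
Qed.

(** Both vectors are, almost surely, the image under [exp_sum_prod] of the vectors
    of [levy_restart_law]; the exceptional event is [L 0 <> 0]. *)
Lemma exp_levy_stationary_restart {R : realType} {d} {Omega : measurableType d}
    (P : probability Omega R) (L Y : R -> Omega -> R) (a : R) (m : nat)
    (s : m.-tuple R) (B : set (m.-tuple R)) :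
  levy_process P L -> (forall t, measurable_fun setT (Y t)) ->
  strictly_stationary P Y ->
  independent_processes P `[0, +oo[ L setT Y ->
  0 <= a -> (forall i, 0 <= tnth s i) -> measurable B ->
  P [set w | B [tuple expR (L (a + tnth s i) w) * Y (- (a + tnth s i)) w | i < m]] =
  (P \x P)%E [set w | B [tuple expR (increment L 0 a w.2) *
      (expR (L (tnth s i) w.1) * Y (- tnth s i) w.1) | i < m]].
Proof.
move=> hL mY Ystat LY a0 s0 mB.
have [[mL _] L0 _ _ _] := hL.
have mL' t : 0 <= t -> measurable_fun setT (L t).
  by move=> t0; apply: mL; rewrite /= in_itv/= t0.
have [u [u0 uS us]] : exists u : nat -> R, [/\ u 0%N = 0, forall i, u i <= u i.+1
    & forall x, x \in val s -> exists2 k, (k <= size s)%N & u k = x].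
  by apply: nondecreasing_grid => x /tnthP[i ->].
have u_ge0 i : 0 <= u i by elim: i => [|i /le_trans]; [rewrite u0|apply].
have /choice[k kP] i : exists k, (k <= m)%N /\ u k = tnth s i.
  by have [k km <-] := us _ (mem_tnth i s); exists k; rewrite size_tuple in km.
pose V w := [tuple Y (- (a + tnth s i)) w | i < m].
pose W w := [tuple Y (- tnth s i) w | i < m].
have oV (y : 'I_m -> R) : observable setT Y (fun w => [tuple Y (y i) w | i < m]).
  apply/measurable_fun_tnthP => i.
  rewrite (_ : _ \o _ = Y (y i)); first exact: observable_coord.
  by apply/funext => w /=; rewrite tnth_mktuple.
have VW : eqlaw P V P W.
  move=> C mC; have := Ystat (- a) m [tuple - tnth s i | i < m] (fun=> I) C mC.
  have -> : sample Y [tuple - tnth s i | i < m] = W.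
    by apply/funext => w; apply: eq_from_tnth => i; rewrite !tnth_mktuple.
  have -> // : sample (fun t => Y (t - a)) [tuple - tnth s i | i < m] = V.
  apply/funext => w; apply: eq_from_tnth => i; rewrite !tnth_mktuple.
  by congr (Y _ _); ring.
have law := levy_restart_law P L Y V W m a u hL mY LY (oV _) (oV _) VW a0 u0 uS.
pose EV w := ([tuple (if i : nat is j.+1
                         then increment L (a + u j) (a + u j.+1)
                         else increment L 0 a) w | i < m.+1], V w).
pose FW w := ([tuple if i : nat is j.+1
                        then increment L (u j) (u j.+1) w.1
                        else increment L 0 a w.2 | i < m.+1], W w.1).
pose G := @exp_sum_prod R m m k.
have mG : measurable_fun setT G by exact: measurable_exp_sum_prod.
have mI x y : 0 <= x -> 0 <= y -> measurable_fun setT (increment L x y).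
  by move=> x0 y0; apply: measurable_funB; exact: mL'.
have mX (t : 'I_m -> R) : (forall i, 0 <= t i) ->
    measurable_fun setT (fun w => [tuple expR (L (t i) w) * Y (- t i) w | i < m]).
  move=> t0; apply/measurable_fun_tnthP => i.
  rewrite (_ : _ \o _ = (expR \o L (t i)) \* Y (- t i)); last first.
    by apply/funext => w /=; rewrite tnth_mktuple.
  by apply: measurable_funM => //; apply: measurableT_comp => //; exact: mL'.
have mFst (t : 'I_m -> R) : (forall i, 0 <= t i) -> measurable_fun setT
    (fun w : Omega * Omega => [tuple expR (increment L 0 a w.2) *
      (expR (L (t i) w.1) * Y (- t i) w.1) | i < m]).
  move=> t0; apply/measurable_fun_tnthP => i.
  rewrite (_ : _ \o _ = (fun w : Omega * Omega => expR (increment L 0 a w.2) *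
      (expR (L (t i) w.1) * Y (- t i) w.1))); last first.
    by apply/funext => w /=; rewrite tnth_mktuple.
  apply: measurable_funM.
    apply: (measurableT_comp (@measurable_expR R)).
    exact: (measurableT_comp (mI _ _ (lexx 0) a0) measurable_snd).
  have mLY : measurable_fun setT (fun w => expR (L (t i) w) * Y (- t i) w).
    by apply: measurable_funM => //; apply: measurableT_comp => //; exact: mL'.
  exact: (measurableT_comp mLY measurable_fst).
have mE : measurable_fun setT EV.
  apply: measurable_fun_pair; last by apply: observable_measurable (oV _) => t _; exact: mY.
  apply: (@measurable_fun_mktuple _ _ _ _ m.+1 (fun i => if i is j.+1
      then increment L (a + u j) (a + u j.+1) else increment L 0 a)).
  by case=> [|j] _; apply: mI; rewrite ?addr_ge0.
have mF : measurable_fun setT FW.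
  apply: measurable_fun_pair; last first.
    have mW : measurable_fun setT W.
      by apply: observable_measurable (oV _) => t _; exact: mY.
    exact: (measurableT_comp mW measurable_fst).
  apply: (@measurable_fun_mktuple _ _ _ _ m.+1 (fun i w => if i is j.+1
      then increment L (u j) (u j.+1) w.1 else increment L 0 a w.2)).
  case=> [|j] _.
    exact: (measurableT_comp (mI _ _ (lexx 0) a0) measurable_snd).
  exact: (measurableT_comp (mI _ _ (u_ge0 _) (u_ge0 _)) measurable_fst).
have inordE (i : 'I_m) (l : nat) : (l <= k i)%N -> (inord l : 'I_m.+1) = l :> nat.
  by move=> lk; rewrite inordK// ltnS (leq_trans lk)//; have [] := kP i.
have XE : {ae P, forall w, [tuple expR (L (a + tnth s i) w) *
    Y (- (a + tnth s i)) w | i < m] = (G \o EV) w}.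
  apply: filterS L0 => w L0w; apply: eq_from_tnth => i; rewrite !tnth_mktuple /=.
  have [ki <-] := kP i; congr (expR _ * _).
  rewrite (telescope_increment L (fun j => a + u j)) u0 addr0.
  rewrite big_nat_recl// tnth_mktuple (inordE i)//.
  rewrite /increment L0w subr0; congr (_ + _).
  rewrite !big_nat; apply: eq_bigr => j jk.
  by rewrite tnth_mktuple (inordE i).
have FE : {ae (P \x P)%E, forall w, [tuple expR (increment L 0 a w.2) *
      (expR (L (tnth s i) w.1) * Y (- tnth s i) w.1) | i < m] = (G \o FW) w}.
  have [N [mN PN L0N]] := L0.
  exists (N `*` setT); split; first exact: measurableX.
    transitivity (P N * P setT)%E; first exact: product_measure1E.
    by rewrite PN mul0e.
  move=> w Hw; split => //; apply: L0N => /= L0w; apply: Hw.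
  apply: eq_from_tnth => i; rewrite !tnth_mktuple /=.
  have [ki <-] := kP i; rewrite mulrA -expRD; congr (expR _ * _).
  rewrite (telescope_increment L u) u0 L0w add0r.
  rewrite big_nat_recl// tnth_mktuple (inordE i)//; congr (_ + _).
  rewrite !big_nat; apply: eq_bigr => j jk.
  by rewrite tnth_mktuple (inordE i).
transitivity (P ((G \o EV) @^-1` B)).
  by apply: (eqlaw_ae _ _ _ _ _ XE) => //; [apply: mX => i; rewrite addr_ge0|
    exact: measurableT_comp].
transitivity ((P \x P)%E ((G \o FW) @^-1` B)); last first.
  apply/esym; apply: (eqlaw_ae _ _ _ _ _ FE) => //; first exact: mFst.
  exact: measurableT_comp.
rewrite !comp_preimage; apply: law.
exact: measurable_preimage.
Qed.

(** * The multifractal property *)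

Lemma log_ratio_ge0 {R : realType} (T t : R) :
  0 < T -> `]0, T]%classic t -> 0 <= - ln (t / T).
Proof.
move=> T0 /=; rewrite in_itv/= => /andP[t0 tT].
by rewrite oppr_ge0 ln_le0// ler_pdivrMr// mul1r.
Qed.

Lemma measurable_levy_stationary_product {R : realType} {d}
    {Omega : measurableType d} (T : R) (L Y : R -> Omega -> R) (t : R) :
  (forall t, 0 <= t -> measurable_fun setT (L t)) ->
  (forall t, measurable_fun setT (Y t)) ->
  0 < T -> `]0, T]%classic t ->
  measurable_fun setT (levy_stationary_product T L Y t).
Proof.
move=> mL mY T0 tT; apply: measurable_funM; last exact: mY.
by apply: measurableT_comp => //; apply: mL; exact: log_ratio_ge0.
Qed.

(** All marginals of [Y] have the same law, so one null value makes [Y] null; this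
    is why [X], which determines [Y 0], is not identically null. *)
Lemma strictly_stationary_ae0 {R : realType} {d} {Omega : measurableType d}
    (P : probability Omega R) (Y : R -> Omega -> R) (t u : R) :
  strictly_stationary P Y -> (forall t, measurable_fun setT (Y t)) ->
  {ae P, forall w, Y t w = 0} -> {ae P, forall w, Y u w = 0}.
Proof.
move=> statY mY Yt0.
pose B := (fun x : 1.-tuple R => tnth x ord0) @^-1` (~` [set 0]).
have mB : measurable B.
  by apply: measurable_preimage; [exact: measurable_tnth|exact: measurableC].
have := statY (u - t) 1%N [tuple t] (fun=> I) B mB.
have mYu v : measurable (Y v @^-1` (~` [set 0])).
  by apply: measurable_preimage => //; exact: measurableC.
rewrite (_ : _ @^-1` B = Y u @^-1` (~` [set 0])); last first.
  apply/seteqP; split => w /=; rewrite /B/= tnth_mktuple (tnth_nth 0)/=;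
    by rewrite addrC subrK.
rewrite (_ : _ @^-1` B = Y t @^-1` (~` [set 0])); last first.
  by apply/seteqP; split => w /=; rewrite /B/= tnth_mktuple (tnth_nth 0)/=.
rewrite (measure_negligible (mYu t) Yt0) => Pu0.
by exists (Y u @^-1` (~` [set 0])); split.
Qed.

(** Events of a process read on one factor of a product space are cylinders over
    that factor; this makes [M] and [X] independent under [P \x P]. *)
Lemma process_sigma_comp {R : realType} {d d'} {Omega : measurableType d}
    {Omega' : measurableType d'} (D : set R) (X : R -> Omega -> R)
    (f : Omega' -> Omega) A :
  (forall t, D t -> measurable_fun setT (X t)) ->
  process_sigma D (fun t => X t \o f) A ->
  exists2 A', measurable A' & A = f @^-1` A'.
Proof.
move=> mX sA.
suff [A' mA' <-] : preimage_set_system setT f measurable A.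
  by exists A' => //; rewrite setTI.
apply: sA; split.
  exact: sigma_algebra_preimage (sigma_algebra_measurable _).
move=> _ [t [B [Dt mB ->]]]; exists (X t @^-1` B); last by rewrite setTI.
exact: measurable_preimage (mX t Dt) mB.
Qed.

(** With [a = - ln l] the scaling identity is [exp_levy_stationary_restart] at the
    times [- ln (t / T)]. *)
Lemma levy_stationary_product_multifractal {R : realType} {d}
    {Omega : measurableType d} (P : probability Omega R) (T : R)
    (L Y : R -> Omega -> R) :
  0 < T -> levy_process P L -> real_process P setT Y ->
  strictly_stationary P Y -> independent_processes P `[0, +oo[ L setT Y ->
  multifractal P `]0, T] (levy_stationary_product T L Y) `]0, 1] `]0, T].
Proof.
move=> T0 hL [mY' Yn0] statY LY.
have mY t : measurable_fun setT (Y t) by exact: mY'.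
have [[mL' _] _ _ _ _] := hL.
have mL t : 0 <= t -> measurable_fun setT (L t).
  by move=> t0; apply: mL'; rewrite /= in_itv/= t0.
have mX t : `]0, T]%classic t -> measurable_fun setT (levy_stationary_product T L Y t).
  by move=> tT; exact: measurable_levy_stationary_product.
split => //.
- split => // X0; apply: Yn0 => t _; apply: (@strictly_stationary_ae0 _ _ _ _ _ 0) => //.
  have TT : `]0, T]%classic T by rewrite /= in_itv/= T0 lexx.
  apply: filterS (X0 T TT) => w /eqP; rewrite /levy_stationary_product.
  by rewrite mulf_eq0 (gt_eqF (expR_gt0 _)) divff ?lt0r_neq0// ln1 => /eqP.
- by move=> l /=; rewrite in_itv/= => /andP[].
- move=> l t /=; rewrite !in_itv/= => /andP[l0 l1] /andP[t0 tT].
  by rewrite mulr_gt0//= (le_trans _ tT)// ler_piMl// ltW.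
move=> l; rewrite /= in_itv/= => /andP[l0 l1].
have a0 : 0 <= - ln l by rewrite oppr_ge0 ln_le0.
(* [M] reads the second coordinate and [X \o fst] the first one; subtracting
   [L 0], which vanishes only almost surely, makes [M] an increment *)
pose M (t : R) (w : Omega * Omega) := expR (increment L 0 (- ln l) w.2).
have mI : measurable_fun setT (expR \o increment L 0 (- ln l)).
  by apply: measurableT_comp => //; apply: measurable_funB; exact: mL.
have mM t : measurable_fun setT (M t) by exact: (measurableT_comp mI measurable_snd).
exists _, (Omega * Omega)%type, (P \x P)%E, fst, M; split => //.
- split => // A mA.
  rewrite (_ : _ @^-1` A = A `*` setT); last by apply/seteqP; split => -[x y] //= [].
  transitivity (P A * P setT)%E; first exact: product_measure1E.
  by rewrite probability_setT mule1.
- by move=> t _; split => // w; rewrite expR_gt0.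
- move=> A B mA mB.
  have {mA} [A' mA' ->] := process_sigma_comp _ (fun=> expR \o increment L 0 (- ln l))
    snd _ (fun _ _ => mI) mA.
  have {mB} [B' mB' ->] := process_sigma_comp _ _ fst _ mX mB.
  rewrite (_ : _ `&` _ = B' `*` A'); last first.
    by apply/seteqP; split => -[x y] /= [].
  rewrite (_ : snd @^-1` A' = setT `*` A'); last first.
    by apply/seteqP; split => -[x y] //= [].
  rewrite (_ : fst @^-1` B' = B' `*` setT); last first.
    by apply/seteqP; split => -[x y] //= [].
  transitivity (P B' * P A')%E; first exact: product_measure1E.
  transitivity ((P setT * P A') * (P B' * P setT))%E.
    by rewrite probability_setT mul1e mule1 muleC.
  by congr (_ * _)%E; apply/esym; exact: product_measure1E.
move=> n t tS B mB.
pose s := [tuple - ln (tnth t i / T) | i < n].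
have s0 i : 0 <= tnth s i by rewrite tnth_mktuple; exact: log_ratio_ge0.
have -> : sample (fun t => levy_stationary_product T L Y (l * t)) t =
    fun w => [tuple expR (L (- ln l + tnth s i) w) * Y (- (- ln l + tnth s i)) w | i < n].
  apply/funext => w; apply: eq_from_tnth => i; rewrite !tnth_mktuple.
  rewrite /levy_stationary_product -mulrA lnM ?posrE// ?opprD ?opprK//.
  have := tS i; rewrite /= in_itv/= => /andP[ti0 _].
  by rewrite divr_gt0.
rewrite [LHS](exp_levy_stationary_restart P L Y _ n s B)//.
congr ((P \x P)%E _); apply/seteqP; split => w /=.
  rewrite /sample; congr B; apply: eq_from_tnth => i; rewrite !tnth_mktuple.
  by rewrite opprK.
rewrite /sample; congr B; apply: eq_from_tnth => i; rewrite !tnth_mktuple.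
by rewrite opprK.
Qed.

(** * Exponential moments of a Levy process *)

Lemma ge0_integrable_expectation {R : realType} {d} {Omega : measurableType d}
    (P : probability Omega R) (U : Omega -> R) :
  measurable_fun setT U -> (forall w, 0 <= U w) -> ('E_P[U] < +oo)%E ->
  P.-integrable setT (EFin \o U).
Proof.
move=> mU U0 EU; apply/integrableP; split; first exact/measurable_EFinP.
move: EU; rewrite unlock; congr (_ < _)%E; apply: eq_integral => w _.
by rewrite /= ger0_norm.
Qed.

(** [`|u * v| <= u ^+ 2 + v ^+ 2]. *)
Lemma integrable_mul_sq {R : realType} {d} {Omega : measurableType d}
    (P : probability Omega R) (U V : Omega -> R) :
  measurable_fun setT U -> measurable_fun setT V ->
  (product_moment P U U < +oo)%E -> (product_moment P V V < +oo)%E ->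
  P.-integrable setT (EFin \o (fun w => U w * V w)).
Proof.
move=> mU mV EU EV.
have sq W : measurable_fun setT W -> (product_moment P W W < +oo)%E ->
    P.-integrable setT (EFin \o (fun w => W w * W w)).
  move=> mW EW; apply: ge0_integrable_expectation => //.
    exact: measurable_funM.
  by move=> w; rewrite -expr2 sqr_ge0.
apply: (le_integrable _ _ _ (integrableD _ (sq U mU EU) (sq V mV EV))) => //.
  by apply/measurable_EFinP; exact: measurable_funM.
move=> w _ /=; rewrite lee_fin -!expr2 (ger0_norm (addr_ge0 _ _)) ?sqr_ge0//.
have := sqr_ge0 (U w); have := sqr_ge0 (V w).
have := sqr_ge0 (U w + V w); have := sqr_ge0 (U w - V w).
by rewrite ler_norml; lra.
Qed.

Lemma ge0_ae_eq_expectation {R : realType} {d} {Omega : measurableType d}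
    (P : probability Omega R) (U V : Omega -> R) :
  measurable_fun setT U -> measurable_fun setT V ->
  (forall w, 0 <= U w) -> (forall w, 0 <= V w) ->
  {ae P, forall w, U w = V w} -> ('E_P[U] = 'E_P[V])%E.
Proof.
move=> mU mV U0 V0 UV; rewrite unlock; apply: ge0_ae_eq_integral => //.
- exact/measurable_EFinP.
- exact/measurable_EFinP.
- by move=> w _; rewrite lee_fin.
- by move=> w _; rewrite lee_fin.
- by apply: filterS UV => w -> _.
Qed.

Section levy_moments.
Context {R : realType} {d} {Omega : measurableType d}.
Variables (P : probability Omega R) (L : R -> Omega -> R) (psi : R -> R).
Hypotheses (hL : levy_process P L) (hpsi : laplace_exponent_on P L `[0, 2] psi).

Let mL t : 0 <= t -> measurable_fun setT (L t).
Proof. by case: hL => -[mL _] _ _ _ _ t0; apply: mL; rewrite /= in_itv/= t0. Qed.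

Let mI s t : 0 <= s -> 0 <= t -> measurable_fun setT (increment L s t).
Proof. by move=> s0 t0; apply: measurable_funB; exact: mL. Qed.

Lemma mgf_increment s t q : 0 <= s -> s <= t -> `[0, 2]%classic q ->
  'M_P (increment L s t) q = (expR ((t - s) * psi q))%:E.
Proof.
move=> s0 st q02; have h0 : 0 <= t - s by rewrite subr_ge0.
have t0 := le_trans s0 st.
have [_ L0 _ statL _] := hL.
have me : measurable_fun setT (fun x : R => expR (x * q)).
  by apply: measurableT_comp => //; apply: measurable_funM.
rewrite -(hpsi _ _ q02 h0) /mmt_gen_fun.
rewrite (@ge0_eqlaw_expectation _ _ _ _ _ _ _ P P _ (increment L 0 (t - s))
  (fun x => expR (x * q)))//; last 3 first.
- exact: mI.
- exact: mI.
- by move=> B mB; rewrite -(statL _ _ s0 h0 B mB) addrC subrK.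
apply: ge0_ae_eq_expectation.
- by apply: (measurableT_comp me); exact: mI.
- by apply: (measurableT_comp me); exact: mL.
- by move=> w; exact: expR_ge0.
- by move=> w; exact: expR_ge0.
- by apply: filterS L0 => w L0w; rewrite /= /increment L0w subr0.
Qed.

(** [L a + L b = 2 * (L b - L 0) + (L a - L b)] almost surely, a sum of two
    independent terms.  This is where the exponents [2] and [1] enter. *)
Lemma expectation_exp_levy2 a b : 0 <= b -> b <= a ->
  ('E_P[fun w => (expR (L a w) * expR (L b w))%R] =
   (expR (b * psi 2 + (a - b) * psi 1))%:E)%E.
Proof.
move=> b0 ba; have a0 := le_trans b0 ba.
have [_ L0 incL _ _] := hL.
pose U1 w := expR (increment L 0 b w * 2); pose U2 w := expR (increment L b a w * 1).
have mU q s t : 0 <= s -> 0 <= t ->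
    measurable_fun setT (fun w => expR (increment L s t w * q)).
  move=> s0 t0; apply: measurableT_comp => //.
  by apply: measurable_funM => //; exact: mI.
have mU1 : measurable_fun setT U1 by exact: mU.
have mU2 : measurable_fun setT U2 by exact: mU.
have E1 : ('E_P[U1] = (expR (b * psi 2))%:E)%E.
  by rewrite -[in RHS](subr0 b) -mgf_increment// /= in_itv/= ler0n lexx.
have E2 : ('E_P[U2] = (expR ((a - b) * psi 1))%:E)%E.
  by rewrite -mgf_increment// /= in_itv/= ler01 ler1n.
have U12 : indep P U1 U2.
  move=> A B mA mB.
  have me q (C : set R) : measurable C -> measurable ((fun x => expR (x * q)) @^-1` C).
    move=> mC; apply: measurable_preimage => //.
    by apply: measurableT_comp => //; apply: measurable_funM.
  have := incL 2%N (nth a [:: 0; b]) (lexx 0).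
  move=> /(_ _ (nth setT [:: (fun x => expR (x * 2)) @^-1` A;
                             (fun x => expR (x * 1)) @^-1` B])).
  rewrite big_nat_recl// big_nat1 => <-.
  - congr (P _); apply/seteqP; split => w /=.
      by move=> [Aw Bw] [|[|]].
    by move=> h; split; [exact: (h 0%N)|exact: (h 1%N)].
  - by case=> [|[|[|i]]].
  - by case=> [|[|i]]; rewrite /= ?nth_nil//; exact: me.
have iU1 : P.-integrable setT (EFin \o U1).
  by apply: ge0_integrable_expectation => // [w|]; rewrite ?expR_ge0// E1 ltry.
have iU2 : P.-integrable setT (EFin \o U2).
  by apply: ge0_integrable_expectation => // [w|]; rewrite ?expR_ge0// E2 ltry.
have [_ E12] := integrable_expectation_mul_indep P U1 U2 U12 iU1 iU2.
rewrite expRD EFinM -E1 -E2 -E12; apply: ge0_ae_eq_expectation.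
- by apply: measurable_funM; apply: measurableT_comp => //; exact: mL.
- exact: measurable_funM.
- by move=> w; rewrite mulr_ge0 ?expR_ge0.
- by move=> w; rewrite mulr_ge0 ?expR_ge0.
- apply: filterS L0 => w L0w; rewrite /U1 /U2 /increment L0w -!expRD.
  by congr expR; ring.
Qed.

End levy_moments.

(** * Product moments of the multifractal process *)

Lemma product_momentC {R : realType} {d} {Omega : measurableType d}
    (P : probability Omega R) (U V : Omega -> R) :
  product_moment P U V = product_moment P V U.
Proof. by rewrite /product_moment; congr expectation; apply/funext => w; rewrite mulrC. Qed.

Section levy_stationary_product_moments.
Context {R : realType} {d} {Omega : measurableType d}.
Variables (P : probability Omega R) (T : R) (L Y : R -> Omega -> R) (psi : R -> R).
Hypotheses (T0 : 0 < T) (hL : levy_process P L)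
  (hpsi : laplace_exponent_on P L `[0, 2] psi)
  (mY : forall t, measurable_fun setT (Y t))
  (hgamma : covariance_function P Y (gamma P Y psi))
  (LY : independent_processes P `[0, +oo[ L setT Y).

Local Notation X := (levy_stationary_product T L Y).
Local Notation K := (fine (product_moment P (Y 0) (Y 0))).

Let mL t : 0 <= t -> measurable_fun setT (L t).
Proof. by case: hL => -[mL _] _ _ _ _ t0; apply: mL; rewrite /= in_itv/= t0. Qed.

Lemma product_moment_exp_scale (t s : R) : 0 < t -> t <= s -> s <= T ->
  product_moment P (X t) (X s) =
  (expR (- ln (s / T) * psi 2 + (ln (s / T) - ln (t / T)) * psi 1) *
   gamma P Y psi (ln (s / T) - ln (t / T)))%:E.
Proof.
move=> t0 ts sT; have s0 := lt_le_trans t0 ts.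
have [Y2 Ycov] := hgamma.
have b0 : 0 <= - ln (s / T) by apply: log_ratio_ge0; rewrite //= in_itv/= s0.
have ba : - ln (s / T) <= - ln (t / T).
  by rewrite lerN2 ler_ln ?posrE ?divr_gt0// ler_pM2r ?invr_gt0.
have a0 := le_trans b0 ba.
pose U w := expR (L (- ln (t / T)) w) * expR (L (- ln (s / T)) w).
pose V w := Y (ln (t / T)) w * Y (ln (s / T)) w.
have EU := expectation_exp_levy2 P L psi hL hpsi _ _ b0 ba.
have EV : product_moment P (Y (ln (t / T))) (Y (ln (s / T))) =
    (gamma P Y psi (ln (s / T) - ln (t / T)))%:E.
  by rewrite product_momentC -(Ycov (ln (t / T))) ?subrKC//; rewrite subr_ge0 -lerN2.
have mU : measurable_fun setT U.
  by apply: measurable_funM; apply: measurableT_comp => //; exact: mL.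
have iU : P.-integrable setT (EFin \o U).
  apply: ge0_integrable_expectation => // [w|]; last by rewrite EU ltry.
  by rewrite mulr_ge0 ?expR_ge0.
have iV : P.-integrable setT (EFin \o V) by apply: integrable_mul_sq.
have UV : indep P U V.
  apply: (independent_processes_indep _ _ _ _ _ _ _ LY).
    apply: measurable_funM; apply: measurableT_comp => //;
      by apply: observable_coord; rewrite /= in_itv/= andbT.
  by apply: measurable_funM; exact: observable_coord.
have [_ EUV] := integrable_expectation_mul_indep P U V UV iU iV.
rewrite [LHS](_ : _ = 'E_P[fun w => (U w * V w)%R])%E; last first.
  congr expectation; apply/funext => w.
  by rewrite /levy_stationary_product /U /V; ring.
by rewrite EUV EU -/(product_moment P _ _) EV EFinM opprK (addrC _ (ln (s / T))).
Qed.

(** The function [gamma] is made for this identity: [exp (- psi 1 * h)] cancels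
    the [psi 1] term, [exp (- h) = t / s], and [1 - t / s] times [s] is [s - t]. *)
Lemma gamma_scale (t s : R) : 0 < t -> t <= s ->
  expR (- ln (s / T) * psi 2 + (ln (s / T) - ln (t / T)) * psi 1) *
   gamma P Y psi (ln (s / T) - ln (t / T)) =
  2^-1 * T `^ psi 2 * K *
  (t `^ (- psi 2) + s `^ (- psi 2) - `|t - s| `^ (- psi 2)).
Proof.
move=> t0 ts; have s0 := lt_le_trans t0 ts.
have ratio : expR (- (ln (s / T) - ln (t / T))) = t / s.
  rewrite opprB !ln_div ?posrE//.
  rewrite (_ : _ - _ - (_ - _) = ln t - ln s); last by ring.
  by rewrite -ln_div ?posrE// lnK ?posrE// divr_gt0.
have dist : `|t - s| `^ (- psi 2) = s `^ (- psi 2) * (1 - t / s) `^ (- psi 2).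
  rewrite -powRM ?(ltW s0)//; last by rewrite subr_ge0 ler_pdivrMr// mul1r.
  congr (_ `^ _); rewrite distrC ger0_norm ?subr_ge0//.
  by field; rewrite gt_eqF.
rewrite dist /gamma ratio; set Z := (1 - t / s) `^ _.
have powE x r : 0 < x -> x `^ r = expR (r * ln x) by move=> x0; rewrite /powR gt_eqF.
rewrite !powE// !ln_div ?posrE//.
set lt := ln t; set ls := ln s; set lT := ln T; clearbody lt ls lT Z.
have -> : expR (- (ls - lT) * psi 2 + (ls - lT - (lt - lT)) * psi 1) =
    expR (psi 2 * lT) * expR (- psi 2 * ls) * expR (psi 1 * (ls - lt)).
  by rewrite -!expRD; congr expR; ring.
have -> : expR (- psi 1 * (ls - lT - (lt - lT))) = (expR (psi 1 * (ls - lt)))^-1.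
  by rewrite -expRN; congr expR; ring.
have -> : expR (psi 2 * (ls - lT - (lt - lT))) =
    expR (- psi 2 * lt) / expR (- psi 2 * ls).
  by rewrite -expRN -expRD; congr expR; ring.
by field; rewrite !gt_eqF ?expR_gt0.
Qed.

Lemma fine_product_moment_T : fine (product_moment P (X T) (X T)) = K.
Proof.
rewrite product_moment_exp_scale// subrr divff ?gt_eqF// ln1 oppr0 !mul0r addr0.
have [_ Ycov] := hgamma.
by have := Ycov 0 0 (lexx 0); rewrite addr0 expR0 mul1r => ->.
Qed.

Lemma product_moment_levy_stationary (t s : R) :
  `]0, T]%classic t -> `]0, T]%classic s ->
  product_moment P (X t) (X s) =
  (2^-1 * T `^ psi 2 * fine (product_moment P (X T) (X T)) *
   (t `^ (- psi 2) + s `^ (- psi 2) - `|t - s| `^ (- psi 2)))%:E.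
Proof.
rewrite fine_product_moment_T /= !in_itv/= => /andP[t0 tT] /andP[s0 sT].
wlog ts : t s t0 tT s0 sT / t <= s.
  move=> h; have [/h->//|/ltW /h st] := leP t s.
  by rewrite product_momentC st// distrC (addrC (s `^ _)).
by rewrite product_moment_exp_scale// gamma_scale.
Qed.

(** At [h = 0] the power [0 `^ (- psi 2)] is [1] when [psi 2 = 0], and then
    [gamma 0 = K / 2] while the covariance at [0] is [K]. *)
Lemma second_moment_degenerate : psi 2 = 0 -> K = 0.
Proof.
move=> psi0; have [_ Ycov] := hgamma.
have := Ycov 0 0 (lexx 0); rewrite addr0 => KE.
have : K = gamma P Y psi 0 by rewrite KE.
rewrite /gamma psi0 !(oppr0, mulr0, mul0r) expR0 powRr0.
by move=> KE'; lra.
Qed.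

(** The term [`|t - t| `^ (- psi 2)] vanishes unless [psi 2 = 0], in which case
    both sides vanish. *)
Lemma second_moment_levy_stationary (t : R) : `]0, T]%classic t ->
  product_moment P (X t) (X t) =
  (T `^ psi 2 * fine (product_moment P (X T) (X T)) * t `^ (- psi 2))%:E.
Proof.
move=> tT; rewrite product_moment_levy_stationary// fine_product_moment_T.
have [psi0|psi0] := eqVneq (psi 2) 0.
  by rewrite second_moment_degenerate// !(mulr0, mul0r).
rewrite subrr normr0 powR0 ?oppr_eq0// subr0.
by congr EFin; field.
Qed.

End levy_stationary_product_moments.

(** * Increments along a regular grid *)

Lemma product_moment_increments {R : realType} {d} {Omega : measurableType d}
    (P : probability Omega R) (D : set R) (X : R -> Omega -> R)
    (C : R -> R -> R) (s t u v : R) :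
  (forall x, D x -> measurable_fun setT (X x)) ->
  (forall x y, D x -> D y -> product_moment P (X x) (X y) = (C x y)%:E) ->
  D s -> D t -> D u -> D v ->
  product_moment P (increment X s t) (increment X u v) =
  (C t v - C t u - (C s v - C s u))%:E.
Proof.
move=> mX CX Ds Dt Du Dv.
pose XX x y w := X x w * X y w.
have L1 x y : D x -> D y -> XX x y \in Lfun P 1.
  move=> Dx Dy; apply/Lfun1_integrable; apply: integrable_mul_sq;
    by [exact: mX|rewrite CX// ltry].
have L2 x : D x -> XX x v \- XX x u \in Lfun P 1.
  by move=> Dx; apply: rpredB; exact: L1.
have E x : D x -> ('E_P[(XX x v \- XX x u)%R] = (C x v - C x u)%:E)%E.
  move=> Dx; rewrite expectationB ?L1// EFinB; congr (_ - _)%E; exact: CX.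
rewrite EFinB -!E// -expectationB ?L2//; congr expectation.
by apply/funext => w; rewrite /increment /XX /=; ring.
Qed.

(** Along a grid of step [eps] the function [H] below is evaluated at multiples of
    [eps], and being homogeneous of degree [- psi 2] it releases the factor
    [eps `^ (- psi 2)]; as it is even, its second difference at [j - i] depends on
    [`|j - i|] only. *)
Theorem proposition5p2 (R : realType) (d : measure_display)
    (Omega : measurableType d) (P : probability Omega R)
    (T : R) (L Y : R -> Omega -> R) (psi : R -> R)
    (hT : 0 < T)
    (hL : levy_process P L)
    (hpsi : laplace_exponent_on P L `[0, 2] psi)
    (hY : real_process P setT Y)
    (hYstat : strictly_stationary P Y)
    (hgamma : covariance_function P Y (gamma P Y psi))
    (hLY : independent_processes P `[0, +oo[ L setT Y) :
  let X := levy_stationary_product T L Y in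
  [/\ multifractal P `]0, T] X `]0, 1] `]0, T],
      (forall t s : R, `]0, T]%classic t -> `]0, T]%classic s ->
         product_moment P (X t) (X s) =
         (2^-1 * T `^ psi 2 * fine (product_moment P (X T) (X T)) *
          (t `^ (- psi 2) + s `^ (- psi 2) - `|t - s| `^ (- psi 2)))%:E),
      (1 <= T ->
         product_moment P (X 1) (X 1) =
         (T `^ psi 2 * fine (product_moment P (X T) (X T)))%:E)
    & forall (eps : R) (tau : nat -> R), 0 < eps ->
        (forall j, tau j.+1 = tau j + eps) ->
        let J := increment_indices T eps tau in
        let Z := fun j : nat => increment X (tau j) (tau j + eps) in
        [/\ weakly_stationary P J Z,
            (forall i j, J i -> J j ->
               product_moment P (Z j) (Z i) =
               (2^-1 * eps `^ (- psi 2) *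
                (T `^ psi 2 * fine (product_moment P (X T) (X T))) *
                (`|j%:R - i%:R + 1| `^ (- psi 2)
                 + `|j%:R - i%:R - 1| `^ (- psi 2)
                 - 2 * `|j%:R - i%:R| `^ (- psi 2)))%:E)
          & (1 <= T -> forall i j, J i -> J j ->
               product_moment P (Z j) (Z i) =
               (2^-1 * eps `^ (- psi 2) * fine (product_moment P (X 1) (X 1)) *
                (`|j%:R - i%:R + 1| `^ (- psi 2)
                 + `|j%:R - i%:R - 1| `^ (- psi 2)
                 - 2 * `|j%:R - i%:R| `^ (- psi 2)))%:E) ] ].
Proof.
move=> X.
have mY t : measurable_fun setT (Y t) by apply: hY.1.
have mX t : `]0, T]%classic t -> measurable_fun setT (X t).
  move=> tT; apply: measurable_levy_stationary_product => // s s0.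
  by case: hL => -[mL _] _ _ _ _; apply: mL; rewrite /= in_itv/= s0.
have EX t s : `]0, T]%classic t -> `]0, T]%classic s ->
    product_moment P (X t) (X s) =
    (2^-1 * T `^ psi 2 * fine (product_moment P (X T) (X T)) *
     (t `^ (- psi 2) + s `^ (- psi 2) - `|t - s| `^ (- psi 2)))%:E.
  by move=> tT sT; exact: product_moment_levy_stationary.
have EX1 : 1 <= T -> product_moment P (X 1) (X 1) =
    (T `^ psi 2 * fine (product_moment P (X T) (X T)))%:E.
  move=> T1; rewrite (second_moment_levy_stationary _ _ _ Y psi)//.
    by rewrite powR1 mulr1.
  by rewrite /= in_itv/= ltr01.
split=> //; first exact: levy_stationary_product_multifractal.
move=> eps tau eps0 tauS J Z.
set K := T `^ psi 2 * fine (product_moment P (X T) (X T)) in EX1 *.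
pose H (x : R) := `|x| `^ (- psi 2).
have EZ i j : J i -> J j -> product_moment P (Z j) (Z i) =
    (2^-1 * eps `^ (- psi 2) * K *
     (H (j%:R - i%:R + 1) + H (j%:R - i%:R - 1) - 2 * H (j%:R - i%:R)))%:E.
  move=> [_ _ ti0 tiT] [_ _ tj0 tjT].
  have [c tauE] : exists c, forall k, tau k = c + k%:R * eps.
    by exists (tau 0%N) => k; elim: k => [|k IH]; rewrite ?mul0r ?addr0// tauS IH -natr1; ring.
  have dom x : 0 < x -> x + eps <= T ->
      `]0, T]%classic x /\ `]0, T]%classic (x + eps).
    move=> x0 xT; rewrite /= !in_itv/= x0 xT addr_gt0//; split => //.
    by rewrite (le_trans _ xT)// lerDl ltW.
  have [Di Di'] := dom _ ti0 tiT; have [Dj Dj'] := dom _ tj0 tjT.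
  rewrite (product_moment_increments P _ X _ _ _ _ _ mX EX)//; congr EFin.
  have HM x : H (x * eps) = H x * eps `^ (- psi 2).
    by rewrite /H normrM (gtr0_norm eps0) powRM// ltW.
  rewrite -/(H (tau j + eps - (tau i + eps))) -/(H (tau j + eps - tau i)).
  rewrite -/(H (tau j - (tau i + eps))) -/(H (tau j - tau i)).
  rewrite (_ : tau j + eps - (tau i + eps) = (j%:R - i%:R) * eps); last first.
    by rewrite !tauE; ring.
  rewrite (_ : tau j + eps - tau i = (j%:R - i%:R + 1) * eps); last first.
    by rewrite !tauE; ring.
  rewrite (_ : tau j - (tau i + eps) = (j%:R - i%:R - 1) * eps); last first.
    by rewrite !tauE; ring.
  rewrite (_ : tau j - tau i = (j%:R - i%:R) * eps); last first.
    by rewrite !tauE; ring.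
  by rewrite !HM /K; field.
split => //; last by move=> T1 i j Ji Jj; rewrite EZ// EX1.
exists (fun n => 2^-1 * eps `^ (- psi 2) * K *
  (H (n%:R + 1) + H (n%:R - 1) - 2 * H n%:R)) => i j Ji Jj.
rewrite EZ//; congr EFin; congr (_ * _).
have HN x : H (- x) = H x by rewrite /H normrN.
have [ij|/ltnW ij] := leqP i j.
  by rewrite distnEl// natrB.
rewrite distnEr// natrB//.
rewrite (_ : j%:R - i%:R + 1 = - (i%:R - j%:R - 1)); last by ring.
rewrite (_ : j%:R - i%:R - 1 = - (i%:R - j%:R + 1)); last by ring.
rewrite (_ : j%:R - i%:R = - (i%:R - j%:R)); last by ring.
by rewrite !HN; ring.
Qed.
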